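(* For integers $n\ge4$ and $1<m<n-1$, let $f_{m,n}:[1,n]\to[1,n]$ be the continuous map with $f_{m,n}(1)=m+1$, $f_{m,n}(j)=j-1$ for every integer $2\le j\le m$, $f_{m,n}(j)=j+1$ for every integer $m+1\le j\le n-1$, $f_{m,n}(n)=m$, and $f_{m,n}$ linear on $[j,j+1]$ for every integer $1\le j\le n-1$. Let $f:[1,4]\to[1,4]$ be the continuous map with $f(1)=f(3)=4$, $f(2)=1$, $f(4)=2$, linear on $[1,2]$, $[2,3]$ and $[3,4]$. For integers $n\ge3$ define the sequence $(a_{n,k})_{k\ge1}$ by $a_{n,k}=2^{k+1}-1$ for $1\le k\le n-1$ and $a_{n,k}=3a_{n,k-1}-\sum_{i=2}^{n-1}a_{n,k-i}$ for $k\ge n$. Then: (a) For every positive integer $k$, $a_{3,k}$ is the number of distinct fixed points of $f^k$ in $[1,4]$; and for every positive integer $k$ and all integers $n\ge4$, $1<m<n-1$, the number of distinct fixed points of $f_{m,n}^k$ in $[1,n]$ is $a_{n,k}$ (in particular independent of $m$). Consequently, for every integer $n\ge3$, setting $\phi_{a_n}(k)=a_{n,k}$, we have $\Phi_1(k,\phi_{a_n})\equiv0\pmod k$ for all integers $k\ge1$. (b) For every integer $n\ge3$, the generating function $G_{a_n}(z)=\sum_{k\ge1}a_{n,k}z^k$ equals $$G_{a_n}(z)=\frac{3z-\sum_{k=2}^{n-1}kz^k}{1-3z+\sum_{k=2}^{n-1}z^k}.$$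
   Context: $f^k$ denotes the $k$-th iterate of $f$. For an integer-valued function $\phi$ on the positive integers: $\Phi_1(1,\phi)=\phi(1)$, and if $m=p_1^{k_1}\cdots p_r^{k_r}$ with $p_1,\dots,p_r$ distinct primes and $r,k_i\ge1$, then $\Phi_1(m,\phi)=\sum_{T\subseteq\{1,\dots,r\}}(-1)^{|T|}\phi\big(m/\prod_{i\in T}p_i\big)$ (empty product $=1$). *)

(* Defs.v *)
From HB Require Import structures.
From mathcomp Require Import all_boot all_order all_algebra.
From mathcomp Require Import all_classical all_reals all_analysis.
From mathcomp Require Import zify ring lra.

Set Implicit Arguments.
Unset Strict Implicit.
Unset Printing Implicit Defensive.

Import Order.TTheory GRing.Theory Num.Theory.
Import numFieldNormedType.Exports.

Local Open Scope classical_set_scope.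
Local Open Scope ring_scope.

(* [:: u (k-1); ...; u 0], where u k = F [:: u (k-1); ...; u 0] *)
Fixpoint history (T : Type) (F : seq T -> T) (k : nat) : seq T :=
  if k is k'.+1 then F (history F k') :: history F k' else [::].

Definition cov_rec (T : Type) (F : seq T -> T) (k : nat) : T := F (history F k).

Lemma size_history (T : Type) (F : seq T -> T) k : size (history F k) = k.
Proof. by elim: k => //= k ->. Qed.

Lemma nth_history (T : Type) (F : seq T -> T) x0 k i : (i < k)%N ->
  nth x0 (history F k) i = cov_rec F (k - i.+1).
Proof.
by elim: k i => //= k IHk [_|i ik] /=; [rewrite subn1 | rewrite IHk // subSS].
Qed.

(* The value at k = 0 is irrelevant: no term of positive index uses it. *)
Definition a_step (n : nat) (s : seq int) : int :=
  if (size s < n)%N then 2 ^+ (size s).+1 - 1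
  else 3 * s`_0 - \sum_(2 <= i < n) s`_i.-1.

Definition a (n k : nat) : int := cov_rec (a_step n) k.

Lemma a_init n k : (1 <= k <= n.-1)%N -> a n k = 2 ^+ k.+1 - 1.
Proof.
move=> hk; rewrite /a /cov_rec /a_step size_history.
by have -> : (k < n)%N by lia.
Qed.

Lemma a_recurrence n k : (3 <= n)%N -> (n <= k)%N ->
  a n k = 3 * a n k.-1 - \sum_(2 <= i < n) a n (k - i).
Proof.
move=> n3 nk; rewrite /a {1}/cov_rec {1}/a_step size_history ltnNge nk /=.
rewrite nth_history ?subn1; last by lia.
congr (_ - _); apply: eq_big_nat => i hi.
by rewrite nth_history; [congr (cov_rec _ _)|]; lia.
Qed.

(* [primes m] lists the distinct primes p_1, ..., p_r dividing m; it is empty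
   for m = 1, and the sum is then phi 1. *)
Definition Phi1 (m : nat) (phi : nat -> int) : int :=
  \sum_(T : {set 'I_(size (primes m))})
    (-1) ^+ #|T| * phi (m %/ \prod_(i in T) nth 1%N (primes m) i)%N.

Lemma Phi1_1 phi : Phi1 1 phi = phi 1%N.
Proof.
rewrite /Phi1 (big_pred1 (finset.set0 : {set 'I_(size (primes 1))})).
  by rewrite cards0 expr0 mul1r big_set0.
by move=> T /=; apply/esym/eqP/setP => -[].
Qed.

Record fps (R : Type) := Fps { fcoef : nat -> R }.

Lemma fpsP (R : Type) (f g : fps R) : fcoef f =1 fcoef g <-> f = g.
Proof. by split=> [|-> //]; case: f g => [f] [g] /= /funext ->. Qed.

HB.instance Definition _ (R : Type) := gen_eqMixin (fps R).
HB.instance Definition _ (R : Type) := gen_choiceMixin (fps R).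

Section FpsZmod.
Variable R : zmodType.
Implicit Types f g h : fps R.

Definition fps_zero : fps R := Fps (fun=> 0).
Definition fps_add f g : fps R := Fps (fun k => fcoef f k + fcoef g k).
Definition fps_opp f : fps R := Fps (fun k => - fcoef f k).

Lemma fps_addA : associative fps_add.
Proof. by move=> f g h; apply/fpsP => k /=; rewrite addrA. Qed.
Lemma fps_addC : commutative fps_add.
Proof. by move=> f g; apply/fpsP => k /=; rewrite addrC. Qed.
Lemma fps_add0 : left_id fps_zero fps_add.
Proof. by move=> f; apply/fpsP => k /=; rewrite add0r. Qed.
Lemma fps_addN : left_inverse fps_zero fps_opp fps_add.
Proof. by move=> f; apply/fpsP => k /=; rewrite addNr. Qed.

HB.instance Definition _ := GRing.isZmodule.Build (fps R)
  fps_addA fps_addC fps_add0 fps_addN.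
End FpsZmod.

Section FpsRing.
Variable R : comNzRingType.
Implicit Types f g h : fps R.

Definition fps_one : fps R := Fps (fun k => (k == 0%N)%:R).
Definition fps_mul f g : fps R :=
  Fps (fun k => \sum_(i < k.+1) fcoef f i * fcoef g (k - i)%N).

Lemma fcoefM f g k : fcoef (fps_mul f g) k =
  \sum_(i < k.+1) fcoef f i * fcoef g (k - i)%N.
Proof. by []. Qed.

Let trunc k f : {poly R} := \poly_(i < k.+1) fcoef f i.

Let fcoef_mul f g k i : (i <= k)%N ->
  fcoef (fps_mul f g) i = (trunc k f * trunc k g)`_i.
Proof.
move=> ik; rewrite coefM /=; apply: eq_bigr => j _.
have jk : (j < k.+1)%N by apply: leq_trans (ltn_ord j) _.
have ijk : (i - j < k.+1)%N by rewrite ltnS (leq_trans (leq_subr _ _)).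
by rewrite !coef_poly jk ijk.
Qed.

Lemma fps_mulC : commutative fps_mul.
Proof. by move=> f g; apply/fpsP => k; rewrite !(@fcoef_mul _ _ k)// mulrC. Qed.

Lemma fps_mulA : associative fps_mul.
Proof.
move=> f g h; apply/fpsP => k; transitivity (trunc k f * trunc k g * trunc k h)`_k.
  rewrite -mulrA coefM fcoefM; apply: eq_bigr => i _.
  by rewrite -(@fcoef_mul _ _ k) ?leq_subr// coef_poly ltn_ord.
rewrite coefM fcoefM; apply: eq_bigr => i _.
have ik : (i <= k)%N by rewrite -ltnS.
by rewrite -(@fcoef_mul _ _ k)// coef_poly ltnS leq_subr.
Qed.

Lemma fps_mul1 : left_id fps_one fps_mul.
Proof.
move=> f; apply/fpsP => k /=; rewrite big_ord_recl /= mul1r subn0 big1 ?addr0//.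
by move=> i _; rewrite mul0r.
Qed.

Lemma fps_mulDl : left_distributive fps_mul (@fps_add R).
Proof.
move=> f g h; apply/fpsP => k /=; rewrite -big_split /=.
by apply: eq_bigr => i _; rewrite mulrDl.
Qed.

Lemma fps_one_neq0 : fps_one != 0.
Proof.
by apply/eqP => /fpsP /(_ 0%N) /= /eqP; rewrite oner_eq0.
Qed.

HB.instance Definition _ := GRing.Zmodule_isComNzRing.Build (fps R)
  fps_mulA fps_mulC fps_mul1 fps_mulDl fps_one_neq0.

Definition fps_X : fps R := Fps (fun k => (k == 1%N)%:R).

End FpsRing.
Arguments fps_X {R}.

Section FpsUnitRing.
Variable R : comUnitRingType.
Implicit Types f g h : fps R.

Definition fps_unit : {pred fps R} := [pred f | fcoef f 0 \is a GRing.unit].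

Definition fps_inv_step f (s : seq R) : R :=
  (fcoef f 0)^-1 *
  ((size s == 0%N)%:R - \sum_(i < size s) fcoef f i.+1 * s`_i).

Definition fps_inv f : fps R :=
  if f \in fps_unit then Fps (cov_rec (fps_inv_step f)) else f.

Lemma fps_mulV : {in fps_unit, left_inverse 1 fps_inv *%R}.
Proof.
move=> f fU; rewrite mulrC /fps_inv fU; apply/fpsP => k /=.
rewrite big_ord_recl /= subn0 {1}/cov_rec {1}/fps_inv_step mulVKr//.
rewrite size_history -[RHS](subrK (\sum_(i < k) fcoef f i.+1 *
  (history (fps_inv_step f) k)`_i)); congr (_ + _).
by apply: eq_bigr => i _; rewrite nth_history.
Qed.

Lemma fps_unitP f g : g * f = 1 -> f \in fps_unit.
Proof.
move=> /fpsP /(_ 0%N) /=; rewrite big_ord_recl big_ord0 /= addr0 => gf1.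
by apply/unitrPr; exists (fcoef g 0); rewrite mulrC.
Qed.

Lemma fps_inv_out : {in [predC fps_unit], fps_inv =1 id}.
Proof. by move=> f; rewrite /fps_inv inE => /negbTE ->. Qed.

HB.instance Definition _ := GRing.ComNzRing_hasMulInverse.Build (fps R)
  fps_mulV fps_unitP fps_inv_out.

End FpsUnitRing.

Definition gen_fun (n : nat) : fps int :=
  Fps (fun k => if (1 <= k)%N then a n k else 0).

Definition gen_num (n : nat) : fps int :=
  3 * fps_X - \sum_(2 <= k < n) k%:R * fps_X ^+ k.

Definition gen_den (n : nat) : fps int :=
  1 - 3 * fps_X + \sum_(2 <= k < n) fps_X ^+ k.

Lemma gen_den_unit n : gen_den n \is a GRing.unit.
Proof.
have X0 k : (0 < k)%N -> fcoef ((fps_X : fps int) ^+ k) 0 = 0.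
  by case: k => // k _; rewrite exprS /= big_ord_recl big_ord0 /= mul0r addr0.
change (fcoef (gen_den n) 0 \is a GRing.unit).
have -> : fcoef (gen_den n) 0 = 1; last exact: unitr1.
rewrite /gen_den /= big_ord_recl big_ord0 /= mulr0 addr0.
suff -> : fcoef (\sum_(2 <= k < n) (fps_X : fps int) ^+ k) 0 = 0 by rewrite addr0.
rewrite big_nat; elim/big_ind: _ => //= [f g -> -> //|k hk].
by rewrite X0//; lia.
Qed.

Section Maps.
Variable R : realType.
Implicit Types f : R -> R.

Definition linear_on (x y : R) f :=
  exists c d : R, forall t, x <= t <= y -> f t = c * t + d.

(* Only the restriction of f to [1, n] matters. *)
Record is_fmn (m n : nat) f : Prop := IsFmn {
  fmn_maps : forall x, 1 <= x <= n%:R -> 1 <= f x <= n%:R;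
  fmn_cont : {within `[1, n%:R], continuous f};
  fmn_1 : f 1 = m.+1%:R;
  fmn_low : forall j : nat, (2 <= j <= m)%N -> f j%:R = j.-1%:R;
  fmn_high : forall j : nat, (m.+1 <= j <= n.-1)%N -> f j%:R = j.+1%:R;
  fmn_n : f n%:R = m%:R;
  fmn_lin : forall j : nat, (1 <= j <= n.-1)%N -> linear_on j%:R j.+1%:R f
}.

Record is_f4 f : Prop := IsF4 {
  f4_maps : forall x, 1 <= x <= 4 -> 1 <= f x <= 4;
  f4_cont : {within `[1, 4], continuous f};
  f4_1 : f 1 = 4;
  f4_2 : f 2 = 1;
  f4_3 : f 3 = 4;
  f4_4 : f 4 = 2;
  f4_lin12 : linear_on 1 2 f;
  f4_lin23 : linear_on 2 3 f;
  f4_lin34 : linear_on 3 4 f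
}.

Definition fixed_points f (k n : nat) : set R :=
  [set x | 1 <= x <= n%:R /\ iter k f x = x].

Definition has_card (A : set R) (z : int) :=
  exists2 N : nat, (A #= `I_N)%card & z = N%:Z.

Definition clamp (x : R) : R := Num.min (Num.max x 0) 1.

Definition interp (v : nat -> nat) (n : nat) (x : R) : R :=
  (v 1%N)%:R +
  \sum_(1 <= i < n) ((v i.+1)%:R - (v i)%:R) * clamp (x - i%:R).

Lemma interpE v n (j : nat) x : (1 <= j < n)%N -> j%:R <= x <= j.+1%:R ->
  interp v n x = (v j)%:R + ((v j.+1)%:R - (v j)%:R) * (x - j%:R).
Proof.
move=> /andP[j1 jn] /andP[jx xj]; rewrite /interp.
rewrite (big_cat_nat (n := j)) //=; last by lia.
rewrite [X in _ + (_ + X)]big_ltn //.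
have -> : \sum_(j.+1 <= i < n) ((v i.+1)%:R - (v i)%:R) * clamp (x - i%:R) = 0.
  rewrite big_nat; apply: big1 => i /andP[ij _].
  have h : j.+1%:R <= i%:R :> R by rewrite ler_nat.
  rewrite /clamp max_r; last by lra.
  by rewrite min_l ?mulr0 ?ler01.
have -> : \sum_(1 <= i < j) ((v i.+1)%:R - (v i)%:R) * clamp (x - i%:R) =
    (v j)%:R - (v 1%N)%:R.
  rewrite -(telescope_sumr (fun i => (v i)%:R : R)) //; apply: eq_big_nat => i.
  move=> /andP[_ ij]; have h : i.+1%:R <= j%:R :> R by rewrite ler_nat.
  rewrite /clamp min_r ?mulr1 // le_max; apply/orP; left.
  by move: h; rewrite -natr1; lra.
have -> : clamp (x - j%:R) = x - j%:R.
  move: xj; rewrite -natr1 => xj.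
  by rewrite /clamp max_l ?min_l //; lra.
by ring.
Qed.

Lemma interp_nat v n (j : nat) : (1 < n)%N -> (1 <= j <= n)%N ->
  interp v n j%:R = (v j)%:R.
Proof.
move=> n1 jn; have [jln|] := ltnP j n.
  rewrite (@interpE _ _ j) ?subrr ?mulr0 ?addr0 ?lexx ?ler_nat ?leqnSn //.
  by lia.
move=> nj; have -> : j = j.-1.+1 by lia.
rewrite (@interpE _ _ j.-1) ?lexx ?ler_nat ?leqnSn //; last by lia.
by rewrite -natr1; ring.
Qed.

Lemma interp_continuous v n : continuous (interp v n).
Proof.
move=> x; apply: cvgD; first exact: cvg_cst.
apply: cvg_big => [|i _]; first exact: add_continuous.
apply: cvgM; first exact: cvg_cst.
have cB : {for x, continuous (fun y : R => y - i%:R)}.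
  by apply: cvgB; [exact: cvg_id | exact: cvg_cst].
have cM := continuous_max cB (@cst_continuous R R 0 x).
exact: (continuous_min cM (@cst_continuous R R 1 x)).
Qed.

Lemma cell (n : nat) (x : R) : (1 < n)%N -> 1 <= x <= n%:R ->
  exists2 j : nat, (1 <= j < n)%N & j%:R <= x <= j.+1%:R.
Proof.
case: n => // -[//|n] _; elim: n => [|n IHn] /andP[x1 xn].
  by exists 1%N => //; rewrite x1.
have [xle|xgt] := leP x n.+2%:R.
  by have [|j jn jx] := IHn; [rewrite x1 | exists j => //; lia].
by exists n.+2; [lia | rewrite ltW].
Qed.

Lemma interp_maps v n : (1 < n)%N ->
  (forall j, (1 <= j <= n)%N -> (1 <= v j <= n)%N) ->
  forall x, 1 <= x <= n%:R -> 1 <= interp v n x <= n%:R.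
Proof.
move=> n1 hv x hx; have [j jn jx] := cell n1 hx.
rewrite (interpE _ jn jx).
have /hv : (1 <= j <= n)%N by lia.
have /hv : (1 <= j.+1 <= n)%N by lia.
rewrite -!(ler_nat R) => /andP[? ?] /andP[? ?].
move: jx; rewrite -natr1 => /andP[? ?]; nra.
Qed.

Lemma interp_linear v n j : (1 <= j < n)%N -> linear_on j%:R j.+1%:R (interp v n).
Proof.
move=> jn; exists ((v j.+1)%:R - (v j)%:R).
exists ((v j)%:R - ((v j.+1)%:R - (v j)%:R) * j%:R) => t ht.
by rewrite (interpE _ jn ht); ring.
Qed.

Lemma is_fmn_exists m n : (4 <= n)%N -> (1 < m < n.-1)%N ->
  exists f, is_fmn m n f.
Proof.
move=> n4 hm.
pose v j := if (j <= 1)%N then m.+1 else if (j <= m)%N then j.-1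
            else if (j < n)%N then j.+1 else m.
have n1 : (1 < n)%N by lia.
exists (interp v n); split.
- by apply: interp_maps => // j; rewrite /v; do ![case: ifP]; lia.
- exact/continuous_subspaceT/interp_continuous.
- by rewrite -[1 in LHS]/(1%:R) interp_nat//; lia.
- move=> j hj; rewrite interp_nat//; last by lia.
  by rewrite /v; do ![case: ifP] => //; lia.
- move=> j hj; rewrite interp_nat//; last by lia.
  by rewrite /v; do ![case: ifP] => //; lia.
- rewrite interp_nat//; last by lia.
  by rewrite /v; do ![case: ifP] => //; lia.
- by move=> j hj; apply: interp_linear; lia.
Qed.

Lemma is_f4_exists : exists f, is_f4 f.
Proof.
pose v j := nth 0%N [:: 0; 4; 1; 4; 2]%N j.
exists (interp v 4); split.
- by apply: interp_maps => // -[|[|[|[|[|]]]]].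
- exact/continuous_subspaceT/interp_continuous.
- exact: (@interp_nat v 4 1).
- exact: (@interp_nat v 4 2).
- exact: (@interp_nat v 4 3).
- exact: (@interp_nat v 4 4).
- exact: (@interp_linear v 4 1).
- exact: (@interp_linear v 4 2).
- exact: (@interp_linear v 4 3).
Qed.

Lemma linear_on_eq (x y : R) f g : x < y -> linear_on x y f -> linear_on x y g ->
  f x = g x -> f y = g y -> forall t, x <= t <= y -> f t = g t.
Proof.
move=> xy [c [d fE]] [c' [d' gE]] fgx fgy t ht.
have hx : x <= x <= y by lra.
have hy : x <= y <= y by lra.
move: fgx fgy; rewrite !fE ?gE // => ex ey.
have : (c - c') * (y - x) = 0 by lra.
move=> /eqP; rewrite mulf_eq0 => /orP[] /eqP h; last by lra.
have cc : c = c' by lra.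
by subst c'; lra.
Qed.

Lemma is_fmn_unique m n f g : (4 <= n)%N -> (1 < m < n.-1)%N ->
  is_fmn m n f -> is_fmn m n g -> forall x, 1 <= x <= n%:R -> f x = g x.
Proof.
move=> n4 hm hf hg x hx; have n1 : (1 < n)%N by lia.
have fgj (j : nat) : (1 <= j <= n)%N -> f j%:R = g j%:R.
  move=> hj; have [->|j1] := eqVneq j 1%N; first by rewrite (fmn_1 hf) (fmn_1 hg).
  have [->|jn] := eqVneq j n; first by rewrite (fmn_n hf) (fmn_n hg).
  have [jm|mj] := leqP j m.
    by rewrite (fmn_low hf) ?(fmn_low hg) //; lia.
  by rewrite (fmn_high hf) ?(fmn_high hg) //; lia.
have [j jn jx] := cell n1 hx.
apply: (@linear_on_eq j%:R j.+1%:R) => //; rewrite ?ltr_nat //.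
- by apply: (fmn_lin hf); lia.
- by apply: (fmn_lin hg); lia.
- by apply: fgj; lia.
- by apply: fgj; lia.
Qed.

Lemma is_f4_unique f g : is_f4 f -> is_f4 g ->
  forall x, 1 <= x <= 4 -> f x = g x.
Proof.
move=> hf hg x /andP[x1 x4].
have e1 : f 1 = g 1 by rewrite (f4_1 hf) (f4_1 hg).
have e2 : f 2 = g 2 by rewrite (f4_2 hf) (f4_2 hg).
have e3 : f 3 = g 3 by rewrite (f4_3 hf) (f4_3 hg).
have e4 : f 4 = g 4 by rewrite (f4_4 hf) (f4_4 hg).
have [x2|x2] := leP x 2.
  by apply: (linear_on_eq _ (f4_lin12 hf) (f4_lin12 hg)) => //; lra.
have [x3|x3] := leP x 3.
  by apply: (linear_on_eq _ (f4_lin23 hf) (f4_lin23 hg)) => //; lra.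
by apply: (linear_on_eq _ (f4_lin34 hf) (f4_lin34 hg)) => //; lra.
Qed.

End Maps.

(* Main.v *)
Require Import Defs.
From mathcomp Require Import all_boot all_order all_algebra.
From mathcomp Require Import all_classical all_reals all_analysis.
From mathcomp Require Import finmap zify ring lra.

Set Implicit Arguments.
Unset Strict Implicit.
Unset Printing Implicit Defensive.

Import Order.TTheory GRing.Theory Num.Theory.

Local Open Scope ring_scope.

(* The maps are piecewise linear and Markov for the partition of [1, n] into unit
   intervals.  Coding an integer point by the side that is periodic under the map
   makes the fixed points of the k-th iterate correspond bijectively to the closed
   walks of length k in the covering graph, so their number is tr(A^k), A being the
   adjacency matrix.

   For f_{m,n}, lift A to functions on the n points: with D the difference operator,
   A D = D B, where B is a signed cyclic permutation matrix plus two diagonal entries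
   equal to 2.  The kernel of D is spanned by the constants, which B fixes, so
   tr(A^k) = tr(B^k) - 1.  Going once around the cycle gives B^(n-2) (B - 2)^2 = 1,
   hence a recurrence for tr(B^k), while a walk of length k < n cannot go around, so
   tr(B^k) = 2^(k+1) for 0 < k < n.  Finally
   (1 - z) (1 - 3z + z^2 + ... + z^(n-1)) = (1 - 2z)^2 - z^n translates one recurrence
   into the other.

   The congruence holds because, by inclusion-exclusion, Phi_1(k, .) counts the points
   of least period k, which split into orbits of size k. *)

(** * Power series coefficients and the generating function *)

Lemma fcoefD (V : zmodType) (g h : fps V) k : fcoef (g + h) k = fcoef g k + fcoef h k.
Proof. by []. Qed.

Lemma fcoefN (V : zmodType) (g : fps V) k : fcoef (- g) k = - fcoef g k.
Proof. by []. Qed.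

Lemma fcoef_sum (V : zmodType) I (r : seq I) (P : pred I) (F : I -> fps V) k :
  fcoef (\sum_(i <- r | P i) F i) k = \sum_(i <- r | P i) fcoef (F i) k.
Proof. exact: (big_morph (fun g => fcoef g k)). Qed.

Lemma fcoefMn (V : zmodType) (g : fps V) j k : fcoef (g *+ j) k = fcoef g k *+ j.
Proof. by elim: j => [//|j IHj]; rewrite !mulrS fcoefD IHj. Qed.

Lemma fcoefXM (S : comNzRingType) (g : fps S) k :
  fcoef (fps_X * g) k = if k is k'.+1 then fcoef g k' else 0.
Proof.
case: k => [|k]; rewrite fcoefM /=.
  by rewrite big_ord_recl big_ord0 /= mul0r addr0.
rewrite big_ord_recl /= mul0r add0r big_ord_recl /= mul1r subSS subn0 big1 ?addr0 //.
by move=> i _; rewrite mul0r.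
Qed.

Lemma fcoefXnM (S : comNzRingType) (g : fps S) i k :
  fcoef (fps_X ^+ i * g) k = if (i <= k)%N then fcoef g (k - i) else 0.
Proof.
elim: i k => [|i IHi] k; first by rewrite expr0 mul1r subn0.
by rewrite exprS -mulrA fcoefXM; case: k => // k; rewrite IHi.
Qed.

Lemma fcoefXn (S : comNzRingType) i k : fcoef ((fps_X : fps S) ^+ i) k = (k == i)%:R.
Proof.
rewrite -[fps_X ^+ i]mulr1 fcoefXnM /=.
have [ik|ki] := leqP i k; last by have -> : (k == i) = false by lia.
by congr (_%:R); lia.
Qed.

Lemma sum_pow2_pred k : \sum_(1 <= i < k) ((2 : int) ^+ i.+1 - 1) =
  if k is 0 then 0 else 2 ^+ k.+1 - 3 - k%:R.
Proof.
case: k => [|k]; first by rewrite big_geq.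
elim: k => [|k IHk]; first by rewrite big_geq.
by rewrite big_nat_recr //= IHk -!natr1 !exprS; ring.
Qed.

Lemma sum_nat_rev_shift (V : nmodType) (u : nat -> V) k :
  \sum_(2 <= i < k) u (k - i)%N = \sum_(1 <= i < k.-1) u i.
Proof.
case: k => [|k]; first by rewrite !big_geq.
rewrite [RHS]big_nat_rev /= big_add1 /=; apply: eq_big_nat => i hi.
by congr u; lia.
Qed.

(** Coefficients of z^k are compared. For k >= n this is the recurrence; for 2 <= k < n the initial
    values, summed by [sum_pow2_pred], leave -k. *)
Lemma gen_fun_mul_den n : (3 <= n)%N -> gen_fun n * gen_den n = gen_num n.
Proof.
move=> n3; apply/fpsP => k.
have -> : gen_fun n * gen_den n = gen_fun n - (fps_X ^+ 1 * gen_fun n) *+ 3 +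
    \sum_(2 <= i < n) fps_X ^+ i * gen_fun n.
  by rewrite -mulr_suml /gen_den expr1; ring.
have -> : gen_num n = fps_X ^+ 1 *+ 3 - \sum_(2 <= i < n) fps_X ^+ i *+ i.
  rewrite /gen_num mulr_natl expr1; congr (_ - _).
  by apply: eq_bigr => i _; rewrite mulr_natl.
rewrite !(fcoefD, fcoefN, fcoefMn, fcoef_sum, fcoefXnM, fcoefXn).
under eq_bigr do rewrite fcoefXnM /= subn_gt0.
under [X in _ = _ - X]eq_bigr do rewrite fcoefMn fcoefXn.
have sum_id : \sum_(2 <= i < n) (k == i)%:R *+ i = (if (2 <= k < n)%N then k%:R else 0 : int).
  case: ifP => hk.
    rewrite (bigD1_seq k) ?mem_index_iota ?iota_uniq //= eqxx big1 ?addr0 //.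
    by move=> i; rewrite eq_sym => /negbTE ->; rewrite mul0rn.
  rewrite big_nat; apply: big1 => i hi.
  by rewrite (_ : (k == i) = false) ?mul0rn //; lia.
rewrite sum_id.
have [k0|k_gt0] := posnP k.
  rewrite k0 /= big1 ?mul0rn ?subr0 //.
  by move=> i _; case: ifP => // /eqP.
have [k1|k_gt1] := leqP k 1.
  have -> : k = 1%N by lia.
  rewrite /= big_nat big1 => [|i hi]; last by case: ifP => //; lia.
  rewrite a_init; last by lia.
  by [].
have [kn|nk] := ltnP k n; last first.
  rewrite /= k_gt0 subn_gt0 k_gt1 /= a_recurrence // subn1.
  have -> : (k == 1)%N%:R = 0 :> int by case: eqP k_gt1 => // ->.
  have -> : \sum_(2 <= i < n) (if (i <= k)%N then if (i < k)%N then a n (k - i) else 0 else 0) =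
     \sum_(2 <= i < n) a n (k - i).
    by apply: eq_big_nat => i hi; rewrite !ifT //; lia.
  by ring.
rewrite /= k_gt0 subn_gt0 k_gt1 /= subn1.
have -> : (k == 1)%N%:R = 0 :> int by case: eqP k_gt1 => // ->.
(* Terms with i >= k vanish: [gen_fun n] has no constant term. *)
rewrite (big_cat_nat (n := k)) //=; last by lia.
rewrite [X in _ + (_ + X) = _]big_nat [X in _ + (_ + X) = _]big1 => [|i hi]; last first.
  by case: ifP => // _; case: ifP => //; lia.
have -> : \sum_(2 <= i < k) (if (i <= k)%N then if (i < k)%N then a n (k - i) else 0 else 0) =
    \sum_(1 <= i < k.-1) ((2 : int) ^+ i.+1 - 1).
  rewrite -(sum_nat_rev_shift (fun i => 2 ^+ i.+1 - 1)).
  apply: eq_big_nat => i hi; rewrite !ifT //; [|lia|lia].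
  by rewrite a_init //; lia.
rewrite sum_pow2_pred !a_init; [|lia|lia].
case: k k_gt1 {sum_id k_gt0 kn} => [|[|k]] // _ /=.
by rewrite -!natr1 !exprS; ring.
Qed.

(** * Gauss congruences for fixed point counts *)

Lemma prod_primes_dvdn s c : uniq s -> all prime s ->
  (\prod_(p <- s) p %| c)%N = all (fun p => p %| c)%N s.
Proof.
elim: s => [|p s IHs] /=; first by rewrite big_nil dvd1n.
move=> /andP[ps us] /andP[pp sp]; rewrite big_cons Gauss_dvd ?IHs //.
rewrite big_seq; elim/big_rec: _ => [|q x qs IH]; first exact: coprimen1.
rewrite coprimeMr IH andbT prime_coprime // dvdn_prime2 //; last exact: (allP sp).
by apply: contra ps => /eqP ->.
Qed.

Lemma dvdn_prod_sub_primes k (S : {set 'I_(size (primes k))}) c :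
  (\prod_(i in S) nth 1 (primes k) i %| c)%N =
  [forall i in S, nth 1 (primes k) i %| c]%N.
Proof.
pose p (i : 'I_(size (primes k))) := nth 1%N (primes k) i.
rewrite -big_enum -(big_map p xpredT id) prod_primes_dvdn.
- rewrite all_map; apply/allP/forall_inP => /= [H i iS|H i].
    by apply: H; rewrite mem_enum.
  by rewrite mem_enum; apply: H.
- rewrite map_inj_uniq ?enum_uniq // => i j /eqP.
  by rewrite nth_uniq ?primes_uniq // => /eqP/val_inj.
- apply/allP => _ /mapP[i _ ->].
  by have := mem_nth 1%N (ltn_ord i); rewrite mem_primes => /andP[].
Qed.

Lemma prod_sub_primes_dvd k (S : {set 'I_(size (primes k))}) :
  (\prod_(i in S) nth 1 (primes k) i %| k)%N.
Proof.
rewrite dvdn_prod_sub_primes; apply/forall_inP => i _.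
by have := mem_nth 1%N (ltn_ord i); rewrite mem_primes => /and3P[].
Qed.

Lemma prod_sub_primes_gt0 k (S : {set 'I_(size (primes k))}) :
  (0 < \prod_(i in S) nth 1 (primes k) i)%N.
Proof.
apply: prodn_gt0 => i; have := mem_nth 1%N (ltn_ord i).
by rewrite mem_primes => /andP[/prime_gt0].
Qed.

(** Orbits of an injective self-map of a finite type are cycles, so [order] is the least period. *)
Lemma iter_eq_dvdn_order (T : finType) (f : T -> T) (x : T) d : injective f ->
  (iter d f x == x) = (order f x %| d)%N.
Proof.
move=> f_inj; have iterM c : iter (c * order f x) f x = x.
  elim: c => [//|c IHc]; rewrite mulSn iterD IHc; exact: iter_order.
rewrite {1}(divn_eq d (order f x)) addnC iterD iterM //.
rewrite /dvdn; set r := (d %% _)%N.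
have r_lt : (r < order f x)%N by rewrite ltn_mod order_gt0.
apply/eqP/eqP => [rx|-> //].
have := findex_iter r_lt; rewrite rx findex0 => <- //.
Qed.

Section GaussCongruence.
Variables (T : finType) (f : T -> T) (k : nat).
Hypotheses (k_gt0 : (0 < k)%N) (f_period : forall x, iter k f x = x).

Let f_inj : injective f.
Proof.
apply: (can_inj (g := iter k.-1 f)) => x.
by rewrite -iterSr prednK.
Qed.

Let p (i : 'I_(size (primes k))) := nth 1%N (primes k) i.

(** Trades a period dividing k / d for d dividing k / order, a condition that splits over the primes
    of a squarefree d. *)
Let order_dvd_div x d : (d %| k)%N -> (0 < d)%N ->
  (iter (k %/ d) f x == x) = (d %| k %/ order f x)%N.
Proof.
move=> dk d0; have ok : (order f x %| k)%N.
  by rewrite -iter_eq_dvdn_order // f_period.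
by rewrite iter_eq_dvdn_order // dvdn_divRL // mulnC -dvdn_divRL.
Qed.

(** Inclusion-exclusion at one point: the sum expands the product of 1 - [p divides k / order] over
    the primes p of k, which has a zero factor unless k / order = 1. *)
Let sum_signs x :
  \sum_(S : {set 'I_(size (primes k))})
    (-1) ^+ #|S| * (iter (k %/ \prod_(i in S) p i) f x == x)%:R =
  (order f x == k)%:R :> int.
Proof.
have ok : (order f x %| k)%N by rewrite -iter_eq_dvdn_order // f_period.
pose b (i : 'I_(size (primes k))) : int := (p i %| k %/ order f x)%N%:R.
transitivity (\prod_i (- b i + 1)).
  rewrite bigA_distr; apply: eq_bigr => S _.
  rewrite -big_mkcond /= prodrN; congr (_ * _).
  rewrite order_dvd_div ?prod_sub_primes_dvd ?prod_sub_primes_gt0 //.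
  rewrite dvdn_prod_sub_primes /b; case: forallP => [H|/forallP].
    by rewrite big1 // => i iS; have := H i; rewrite iS /= => ->.
  rewrite negb_forall => /existsP[i]; rewrite negb_imply => /andP[iS /negbTE ni].
  by rewrite (bigD1 i) //= ni mul0r.
case: eqVneq => [ek|nk].
  apply: big1 => i _; rewrite /b ek divnn k_gt0 dvdn1.
  have := mem_nth 1%N (ltn_ord i); rewrite mem_primes => /andP[/prime_gt1 p1 _].
  by rewrite gtn_eqF ?oppr0 ?add0r.
have q1 : (1 < k %/ order f x)%N.
  rewrite ltn_neqAle divn_gt0 ?order_gt0 // (dvdn_leq k_gt0 ok) andbT eq_sym.
  by apply: contra nk => /eqP q1; rewrite -[X in _ == X](divnK ok) q1 mul1n.
have q_in : pdiv (k %/ order f x) \in primes k.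
  rewrite mem_primes pdiv_prime // k_gt0 /=.
  by apply: dvdn_trans (pdiv_dvd _) _; rewrite dvdn_div.
move: (q_in); rewrite -index_mem => q_idx.
rewrite (bigD1 (Ordinal q_idx)) //= /b /p /= nth_index //.
by rewrite pdiv_dvd addNr mul0r.
Qed.

Lemma Phi1_finite_dynamics :
  (Phi1 k (fun d => #|[pred x | iter d f x == x]|%:Z) = 0 %[mod k%:Z])%Z.
Proof.
have -> : Phi1 k (fun d => #|[pred x | iter d f x == x]|%:Z) =
    #|[pred x | order f x == k]|%:Z.
  rewrite -sum1_card -natz natr_sum big_mkcond /=.
  rewrite (eq_bigr (fun x => (order f x == k)%:R)); last first.
    by move=> x _; rewrite inE; case: eqP.
  under [RHS]eq_bigr do rewrite -sum_signs.
  rewrite exchange_big; apply: eq_bigr => S _ /=.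
  rewrite -big_distrr /=; congr (_ * _).
  rewrite -sum1_card -natz natr_sum big_mkcond /=.
  by apply: eq_bigr => x _; rewrite inE; case: eqP.
(* The points of least period k form a union of cycles of size k. *)
have <- : (fcard f [pred x | order f x == k] * k)%N = #|[pred x | order f x == k]|.
  apply: (fcard_order_set f_inj).
  - by apply/fintype.subsetP => x; rewrite !inE.
  - move=> x y /eqP <-; rewrite !inE; congr (_ == _).
    by rewrite order_id_cycle // cycle_orbit.
by rewrite PoszM modzMl mod0z.
Qed.
End GaussCongruence.

(** The finite set X of fixed points of f^k is stable under f and contains those of f^d for each d
    dividing k. Only such d occur in [Phi1 k], so the finite case applies to f restricted to X. *)
Lemma Phi1_fixed_points (R : realType) (f : R -> R) n phi :
  (forall x, 1 <= x <= n%:R -> 1 <= f x <= n%:R) ->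
  (forall k, (1 <= k)%N -> has_card (fixed_points f k n) (phi k)) ->
  forall k, (1 <= k)%N -> (Phi1 k phi = 0 %[mod k%:Z])%Z.
Proof.
move=> f_maps card_fix k k_gt0.
pose X := fset_set (fixed_points f k n).
have fin d : (0 < d)%N -> finite_set (fixed_points f d n).
  by move=> /card_fix[N XN _]; apply/finite_setP; exists N.
have inX x : reflect (fixed_points f k n x) (x \in X).
  rewrite in_fset_set; last exact: fin.
  by apply: (iffP idP) => [/set_mem|/mem_set].
have fX (x : X) : f (val x) \in X.
  have /inX[xn kx] := valP x; apply/inX; split; first exact: f_maps.
  by rewrite -iterSr /= kx.
pose g (x : X) : X := FSetSub (fX x).
have val_g d x : val (iter d g x) = iter d f (val x).
  by elim: d => //= d ->.
have gk x : iter k g x = x.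
  by apply: val_inj; rewrite val_g; have /inX[] := valP x.
rewrite -(Phi1_finite_dynamics k_gt0 gk); congr (modz _ _).
apply: eq_bigr => S _; congr (_ * _); set q := (\prod_(i in S) _)%N.
have qk : (q %| k)%N by exact: prod_sub_primes_dvd.
set d := (k %/ q)%N; have d_gt0 : (0 < d)%N.
  by rewrite divn_gt0 ?prod_sub_primes_gt0 // dvdn_leq.
have [N XN ->] := card_fix d d_gt0; congr Posz.
rewrite -(card_fset_set XN).
have -> : fset_set (fixed_points f d n) =
    [fset val x | x in [pred x : X | iter d g x == x]]%fset.
  apply/fsetP => x; rewrite in_fset_set; last exact: fin.
  apply/idP/imfsetP => /= [/set_mem[xn dx]|[y]].
    have xX : x \in X.
      apply/inX; split => //; rewrite -(divnK qk) -/d mulnC.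
      by elim: (q) => [//|c IHc]; rewrite mulSn iterD IHc.
    exists (FSetSub xX) => //.
    by apply/eqP/val_inj; rewrite val_g.
  move=> /eqP dy ->; apply/mem_set; split; last by rewrite -val_g dy.
  by have /inX[] := valP y.
by rewrite card_imfset ?cardE //; apply: val_inj.
Qed.

(** * Closed walks, traces and recurrences *)

Section Walks.
Variables (N : nat) (A : rel 'I_N.+1).

Definition adj_mx : 'M[int]_N.+1 := \matrix_(i, j) (A i j)%:R.

Lemma adj_mx_expE k x y : (adj_mx ^+ k) x y =
  \sum_(t : k.-tuple 'I_N.+1) (path A x t && (last x t == y))%:R :> int.
Proof.
elim: k x => [|k IHk] x.
  rewrite expr0 mxE (big_pred1 [tuple]) //= => t; apply/esym/eqP; exact: tuple0.
pose h (q : 'I_N.+1 * k.-tuple 'I_N.+1) : k.+1.-tuple 'I_N.+1 := [tuple of q.1 :: q.2].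
rewrite (reindex h); last first.
  exists (fun t => (thead t, [tuple of behead t])) => [[z t] _|t _] /=.
    by congr (_, _); apply: val_inj.
  by rewrite /h /= [RHS]tuple_eta.
rewrite exprS mxE -(pair_bigA _ (fun z t =>
  (path A x (h (z, t)) && (last x (h (z, t)) == y))%:R)) /=.
apply: eq_bigr => z _; rewrite mxE IHk big_distrr /=; apply: eq_bigr => t _.
by rewrite -natrM mulnb andbA.
Qed.

(** Tuples record the vertices after the start. A closed walk starts at its last vertex, so for k >
    0 the tuple determines it and the default [ord0] is never reached. *)
Lemma mxtrace_adj_mx_exp k : (0 < k)%N -> \tr (adj_mx ^+ k) =
  #|[pred t : k.-tuple 'I_N.+1 | path A (last ord0 t) t]|%:Z.
Proof.
move=> k_gt0; rewrite /mxtrace; under eq_bigr do rewrite adj_mx_expE.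
rewrite exchange_big /= -sum1_card -natz natr_sum [RHS]big_mkcond /=.
apply: eq_bigr => t _.
have lastE x : last x t = last ord0 t.
  by case: t => -[|y s] //= /eqP k0; rewrite -k0 in k_gt0.
rewrite (bigD1 (last ord0 t)) //= lastE eqxx andbT big1 ?addr0 => [|x].
  by rewrite inE; case: path.
by rewrite lastE eq_sym => /negbTE ->; rewrite andbF.
Qed.
End Walks.

(** The recurrence of u is the difference of two consecutive instances of the one wanted for u - 1.
    So only the instance at index n needs checking, and there u 0 = n enters. *)
Lemma a_from_trace n (u : nat -> int) : (3 <= n)%N -> u 0%N = n%:Z ->
  (forall k, (0 < k < n)%N -> u k = 2 ^+ k.+1) ->
  (forall k, u (k + n)%N = 4 * u (k + n).-1 - 4 * u (k + n).-2 + u k) ->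
  forall k, (0 < k)%N -> a n k = u k - 1.
Proof.
move=> n3 u0 u_init u_rec.
pose w k : int := u k - 1.
have w_rec k : w (k + n)%N = 3 * w (k + n).-1 - \sum_(2 <= i < n) w (k + n - i)%N.
  elim: k => [|k IHk].
    rewrite add0n (sum_nat_rev_shift w).
    have -> : \sum_(1 <= i < n.-1) w i = \sum_(1 <= i < n.-1) (2 ^+ i.+1 - 1).
      by apply: eq_big_nat => i hi; rewrite /w u_init //; lia.
    rewrite sum_pow2_pred /w; have := u_rec 0%N; rewrite add0n u0 => ->.
    rewrite !u_init; [|lia|lia].
    case: n n3 {u0 u_init u_rec w} => [|[|[|n]]] // _ /=.
    by rewrite -!natz -!natr1 !exprS; ring.
  (* Shifting the window gains w (k + n - 1) and loses w (k + 1). *)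
  have -> : \sum_(2 <= i < n) w (k.+1 + n - i)%N =
      w (k + n).-1 + \sum_(2 <= i < n) w (k + n - i)%N - w k.+1.
    rewrite big_add1 /= big_ltn; last by lia.
    have -> : \sum_(2 <= i < n) w (k + n - i)%N =
        \sum_(2 <= i < n.-1) w (k + n - i)%N + w k.+1.
      case: n n3 {u0 u_init u_rec IHk} => [|n] //= n3.
      by rewrite big_nat_recr //=; congr (_ + w _); lia.
    rewrite addrA addrK; congr (w _ + _); lia.
  have -> : \sum_(2 <= i < n) w (k + n - i)%N = 3 * w (k + n).-1 - w (k + n)%N.
    by rewrite {1}IHk; ring.
  have := u_rec k.+1; rewrite addSn /= /w => ->; ring.
elim/ltn_ind => k IHk k_gt0; have [kn|nk] := ltnP k n.
  by rewrite a_init ?u_init //; lia.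
rewrite a_recurrence // -/(w k) -(subnK nk) w_rec (subnK nk) /w IHk; [|lia|lia].
congr (_ - _); apply: eq_big_nat => i hi; apply: IHk; lia.
Qed.

(** * Traces of the covering matrices *)

(* Points and intervals are numbered from 0: [p] is the point [p + 1], [i] is the
   interval [[i + 1, i + 2]], and [v p] is the image of the point [p]. *)
Definition covers (v : nat -> nat) (i j : nat) : bool :=
  (minn (v i) (v i.+1) <= j < maxn (v i) (v i.+1))%N.

Definition cover_rel (N : nat) (v : nat -> nat) : rel 'I_N.+1 :=
  fun i j => covers v i j.

(** Here n = N + 2. For 1 < m <= N this is the single cycle 0, m, m + 1, ..., N + 1, m - 1, ..., 1,
    0. *)
Definition fmn_val (N m j : nat) : nat :=
  if j == 0%N then m else if (j < m)%N then j.-1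
  else if (j < N.+1)%N then j.+1 else m.-1.

Section TraceFmn.
Variables (N m : nat).
Hypothesis (m_bnd : (1 < m <= N)%N).
Let v := fmn_val N m.
Let e (p : nat) : 'rV[int]_N.+2 := \row_q (val q == p)%:R.
Let is_end (p : nat) := (p == 0%N) || (p == N.+1).
(** The map reverses orientation only on the two end intervals. As v sends the neighbour of an end p
    to p, replacing e (v p) by 2 e p - e (v p) reverses the sign of the difference there. *)
Let B : 'M[int]_N.+2 :=
  \matrix_(p < N.+2) (if is_end p then e p *+ 2 - e (v p) else e (v p)).
Let A := adj_mx (@cover_rel N v).
Let D : 'M[int]_(N.+1, N.+2) := \matrix_(i < N.+1) (e i.+1 - e i).
Let T : 'M[int]_(N.+2, N.+1) := \matrix_(p, j) (j < p)%N%:R.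

Let e_delta (p : 'I_N.+2) : e p = delta_mx 0 p.
Proof. by apply/rowP => q; rewrite !mxE. Qed.

Let e_mul k (M : 'M[int]_(N.+2, k)) (p : nat) (hp : (p < N.+2)%N) :
  e p *m M = row (Ordinal hp) M.
Proof. by rewrite rowE -e_delta. Qed.

Let e_B p : (p < N.+2)%N ->
  e p *m B = if is_end p then e p *+ 2 - e (v p) else e (v p).
Proof. by move=> hp; rewrite e_mul rowK. Qed.

Let sum_e lo hi : (lo <= hi <= N.+1)%N ->
  \sum_(j < N.+1) (lo <= j < hi)%N%:R *: (e j.+1 - e j) = e hi - e lo.
Proof.
move=> h; rewrite -(telescope_sumr e); last by lia.
rewrite -(big_mkord xpredT (fun j => (lo <= j < hi)%N%:R *: (e j.+1 - e j))).
rewrite (big_cat_nat (n := lo)) /=; [|lia|lia].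
rewrite [X in _ + X](big_cat_nat (n := hi)) /=; [|lia|lia].
rewrite big_nat big1 ?add0r => [|i hi']; last first.
  by rewrite (_ : (_ && _) = false) ?scale0r //; lia.
rewrite [X in _ + X]big_nat [X in _ + X]big1 ?addr0 => [|i hi']; last first.
  by rewrite (_ : (_ && _) = false) ?scale0r //; lia.
by apply: eq_big_nat => i ->; rewrite scale1r.
Qed.

(** Differences over the intervals covered by i telescope to e at the larger minus e at the smaller
    image of its endpoints. *)
Let mulAD : A *m D = D *m B.
Proof.
apply/row_matrixP => i; have iN := ltn_ord i.
rewrite !row_mul [row i D]rowK mulmxBl !e_B; [|lia|lia].
rewrite mulmx_sum_row; under eq_bigr do rewrite !mxE rowK /cover_rel /covers.
rewrite sum_e; last first.
  by rewrite /v /fmn_val; do ![case: ifP => ?]; lia.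
have [i0|i_gt0] := posnP i.
  have -> : is_end i by rewrite i0.
  have -> : is_end i.+1 = false by rewrite i0 /is_end; lia.
  have v0 : v 0 = m by [].
  have v1 : v 1 = 0%N by rewrite /v /fmn_val /= ifT //; lia.
  rewrite i0 v0 v1 (_ : maxn m 0 = m) 1?(_ : minn m 0 = 0%N); [|lia|lia].
  by rewrite mulr2n !opprD opprK addrA addrA subrr add0r addrC.
have [iN'|i_lt] := eqVneq (i : nat) N.
  have -> : is_end i.+1 by rewrite iN' /is_end eqxx orbT.
  have -> : is_end i = false by rewrite iN' /is_end; lia.
  have v0 : v N = N.+1 by rewrite /v /fmn_val /=; do ![case: ifP => ?]; lia.
  have v1 : v N.+1 = m.-1 by rewrite /v /fmn_val /=; do ![case: ifP => ?]; lia.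
  rewrite iN' v0 v1 (_ : maxn _ _ = N.+1) 1?(_ : minn _ _ = m.-1); [|lia|lia].
  by rewrite mulr2n addrAC addrK.
rewrite (_ : is_end i = false) 1?(_ : is_end i.+1 = false); first last.
- by rewrite /is_end; lia.
- by rewrite /is_end; lia.
have lt_v : (v i < v i.+1)%N.
  by rewrite /v /fmn_val; do ![case: ifP => ?]; lia.
by rewrite (_ : maxn _ _ = v i.+1) 1?(_ : minn _ _ = v i) //; lia.
Qed.

Let ones : 'cV[int]_N.+2 := const_mx 1.

Let e_ones p : (p < N.+2)%N -> e p *m ones = 1.
Proof. by move=> hp; rewrite e_mul; apply/matrixP => i j; rewrite !mxE !ord1. Qed.

Let v_lt p : (p < N.+2)%N -> (v p < N.+2)%N.
Proof. by rewrite /v /fmn_val; do ![case: ifP => ?]; lia. Qed.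

Let B_ones k : B ^+ k *m ones = ones.
Proof.
have B1 : B *m ones = ones.
  apply/row_matrixP => p; rewrite row_mul rowK.
  have -> : row p ones = 1 by apply/matrixP => i j; rewrite !mxE !ord1.
  case: ifP => _; last by rewrite e_ones // v_lt.
  by rewrite mulmxBl mulr2n mulmxDl !e_ones ?v_lt // addrK.
by elim: k => [|k IHk]; rewrite ?mul1mx // exprSr -mulmxA B1.
Qed.

Let mulDT : D *m T = 1%:M.
Proof.
apply/row_matrixP => i; rewrite row_mul rowK mulmxBl.
have hi := ltn_ord i; have hi1 : (i < N.+2)%N by lia.
have hi2 : (i.+1 < N.+2)%N by lia.
rewrite !e_mul; apply/rowP => j; rewrite !mxE /=.
by rewrite -val_eqE /=; case: (ltngtP i j); rewrite ?ltnS; case: (ltngtP j i) => //; lia.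
Qed.

Let mulTD : T *m D = 1%:M - ones *m e 0.
Proof.
apply/row_matrixP => p; rewrite row_mul mulmx_sum_row.
have -> : row p (1%:M - ones *m e 0) = e p - e 0.
  rewrite linearB /= row1 -e_delta row_mul; congr (_ - _).
  have -> : row p ones = 1 by apply/matrixP => i j; rewrite !mxE !ord1.
  by rewrite mul1mx.
rewrite -(@sum_e 0 p); last by have := ltn_ord p; lia.
by apply: eq_bigr => j _; rewrite !mxE rowK.
Qed.

(** Split 1 = T D + ones e_0. The second summand contributes e_0 B^k ones = 1; the first gives tr (D
    B^k T) = tr (A^k D T) = tr (A^k). *)
Let trAB k : \tr (A ^+ k) = \tr (B ^+ k) - 1.
Proof.
have ADk : A ^+ k *m D = D *m B ^+ k.
  elim: k => [|k IHk]; first by rewrite mul1mx mulmx1.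
  by rewrite exprSr -mulmxA mulAD mulmxA IHk -mulmxA exprSr.
have -> : \tr (B ^+ k) = \tr (B ^+ k *m (T *m D)) + \tr (B ^+ k *m (ones *m e 0)).
  by rewrite -mxtraceD -mulmxDr mulTD subrK mulmx1.
rewrite [B ^+ k *m (ones *m _)]mulmxA B_ones [\tr (ones *m _)]mxtrace_mulC e_ones //.
rewrite mxtrace1 addrK [B ^+ k *m _]mulmxA mxtrace_mulC mulmxA -ADk -mulmxA.
by rewrite mulDT mulmx1.
Qed.

Let e_B_up j : (m + j <= N.+1)%N -> e m *m B ^+ j = e (m + j)%N.
Proof.
elim: j => [|j IHj] mj; first by rewrite mulmx1 addn0.
rewrite exprSr mulmxA IHj ?e_B; [|lia|lia].
have -> : is_end (m + j) = false by rewrite /is_end; lia.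
by congr e; rewrite /v /fmn_val; do ![case: ifP => ?]; lia.
Qed.

Let e_B_down j : (j < m)%N -> e m.-1 *m B ^+ j = e (m.-1 - j)%N.
Proof.
elim: j => [|j IHj] jm; first by rewrite mulmx1 subn0.
rewrite exprSr mulmxA IHj ?e_B; [|lia|lia].
have -> : is_end (m.-1 - j) = false by rewrite /is_end; lia.
by congr e; rewrite /v /fmn_val; do ![case: ifP => ?]; lia.
Qed.

(** At an end p, C sends e p to - e (v p); thus B at inner points and - C at the ends follow the
    cycle v. *)
Let C : 'M[int]_N.+2 := B - 2.

Let e_C p : (p < N.+2)%N -> is_end p -> e p *m C = - e (v p).
Proof.
move=> pN pend; rewrite mulmxBr e_B // pend mulmxDr mulmx1.
by rewrite mulr2n addrAC subrr sub0r.
Qed.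

Let commBC : GRing.comm B C.
Proof. by apply: commrB => //; apply: commr_nat. Qed.

Let Q : 'M[int]_N.+2 := B ^+ N * C ^+ 2.

Let commBQ : GRing.comm B Q.
Proof. by apply: commrM; apply: commrX. Qed.

Let commCQ : GRing.comm C Q.
Proof. by apply: commrM; apply: commrX; first exact: commr_sym. Qed.

(* Every basis row is reached from [e 0] by right multiplications by [B] and
   [- C], so it is enough to follow [e 0] once around the cycle. *)
Let Q1 : Q = 1.
Proof.
have v0 : v 0 = m by [].
have vN : v N.+1 = m.-1 by rewrite /v /fmn_val /=; do ![case: ifP => ?]; lia.
have eC0 : e 0 *m C = - e m by rewrite e_C ?v0.
have eCN : e N.+1 *m C = - e m.-1 by rewrite e_C ?vN ?/is_end ?eqxx ?orbT.
have fix_mul u M : u *m Q = u -> GRing.comm M Q -> (u *m M) *m Q = u *m M.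
  by move=> uQ MQ; rewrite -mulmxA [M *m Q]MQ mulmxA uQ.
(* From 0, - C leads to m, B up to N + 1, - C to m - 1, and B down to 0; commuting the factors
   collects them into Q. *)
have Q0 : e 0 *m Q = e 0.
  have -> : Q = C * B ^+ (N.+1 - m) * C * B ^+ m.-1.
    have BC k : GRing.comm (B ^+ k) C by apply/commr_sym/commrX/commr_sym.
    rewrite -mulrA -(BC m.-1) mulrA -[C * _ * _]mulrA -exprD.
    rewrite -(BC _) /Q expr2 mulrA; congr (B ^+ _ * _ * _); lia.
  rewrite !mulmxA eC0 mulNmx e_B_up; last by lia.
  rewrite (_ : (m + (N.+1 - m))%N = N.+1); last by lia.
  by rewrite mulNmx eCN opprK e_B_down ?subnn //; lia.
have Qm : e m *m Q = e m.
  by rewrite -[e m]opprK -eC0 mulNmx fix_mul.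
have Qup j : (m + j <= N.+1)%N -> e (m + j)%N *m Q = e (m + j)%N.
  by move=> mj; rewrite -e_B_up // fix_mul //; apply/commr_sym/commrX/commr_sym.
have Qm1 : e m.-1 *m Q = e m.-1.
  rewrite -[e m.-1]opprK -eCN mulNmx fix_mul //.
  by have := Qup (N.+1 - m)%N; rewrite subnKC; [apply|]; lia.
apply/row_matrixP => p; rewrite row1 -e_delta rowE -e_delta.
have [pm|mp] := ltnP p m; last first.
  by rewrite -(subnKC mp) Qup //; have := ltn_ord p; lia.
have -> : (p : nat) = (m.-1 - (m.-1 - p))%N by lia.
rewrite -e_B_down ?fix_mul //; last by lia.
by apply/commr_sym/commrX/commr_sym.
Qed.

(** Multiply [Q1] by B^k and expand (B - 2)^2. *)
Let tr_rec k : \tr (B ^+ (k + N.+2)) =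
  4 * \tr (B ^+ (k + N.+2).-1) - 4 * \tr (B ^+ (k + N.+2).-2) + \tr (B ^+ k).
Proof.
have -> : B ^+ k = B ^+ (k + N) * C ^+ 2 by rewrite exprD -mulrA -/Q Q1 mulr1.
have mulC X : X * C = X * B - X *+ 2 by rewrite mulrBr mulr_natr.
have -> : B ^+ (k + N) * C ^+ 2 =
    B ^+ (k + N).+2 - B ^+ (k + N).+1 *+ 4 + B ^+ (k + N) *+ 4.
  rewrite expr2 mulrA !mulC mulrBl mulrnAl -!exprSr mulrnBl -mulrnA opprB addrA.
  by rewrite addrAC -[_ - _ - _]addrA -opprD -mulrnDr.
rewrite !addnS /= mxtraceD raddfB /= ![\tr (_ *+ 4)]raddfMn /=.
by ring.
Qed.

(** Numbers the cycle from m - 1 on, so that v becomes the successor modulo N + 2. *)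
Let pos p := if (p < m)%N then (m.-1 - p)%N else p.

(* The number of steps from [p] to [q] along the cycle [v]. *)
Let dist p q := if (pos p <= pos q)%N then (pos q - pos p)%N
                else (pos q + N.+2 - pos p)%N.

Let B_E (p q : 'I_N.+2) : B p q = if is_end p
  then (q == p :> nat)%:R *+ 2 - (q == v p :> nat)%:R else (q == v p :> nat)%:R.
Proof. by rewrite mxE; case: ifP => _; rewrite !mxE. Qed.

Let pos_lt p : (p < N.+2)%N -> (pos p < N.+2)%N.
Proof. by rewrite /pos; case: ifP => ?; lia. Qed.

Let pos_v p : (p < N.+2)%N ->
  pos (v p) = (pos p).+1 \/ pos (v p) = 0%N /\ pos p = N.+1.
Proof.
by rewrite /v /fmn_val; do ![case: ifP => ?]; rewrite /pos; do ![case: ifP => ?]; lia.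
Qed.

Let dist_v p q : (p < N.+2)%N -> (q < N.+2)%N -> (dist p (v q) <= (dist p q).+1)%N.
Proof.
move=> hp hq; have := pos_lt hp; have := pos_lt hq; have := pos_lt (v_lt hq).
by have := pos_v hq; rewrite /dist; do ![case: ifP => ?]; lia.
Qed.

Let dist_pred q : (q < N.+2)%N -> dist (v q) q = N.+1.
Proof.
move=> hq; have := pos_lt hq; have := pos_lt (v_lt hq).
by have := pos_v hq; rewrite /dist; do ![case: ifP => ?]; lia.
Qed.

Let B_eq0 (p q : 'I_N.+2) : q != p -> q != v p :> nat -> B p q = 0.
Proof. by rewrite B_E -val_eqE => /negbTE -> /negbTE ->; case: ifP. Qed.

(** Each factor B stays or advances one step along the cycle. *)
Let Bk_eq0 k (p q : 'I_N.+2) : (k < dist p q)%N -> (B ^+ k) p q = 0.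
Proof.
elim: k q => [|k IHk] q kd.
  rewrite expr0 mxE; case: eqVneq kd => // ->.
  by rewrite /dist leqnn subnn.
rewrite exprSr mxE big1 // => r _.
have [qr|rq] := eqVneq q r; first by rewrite -qr IHk ?mul0r // ltnW.
have [rv|rv] := eqVneq (q : nat) (v r); last by rewrite B_eq0 ?mulr0.
rewrite IHk ?mul0r // -ltnS (leq_trans kd) // rv.
exact: dist_v.
Qed.

Let Bk_diag k (p : 'I_N.+2) : (k <= N.+1)%N -> (B ^+ k) p p = (B p p) ^+ k.
Proof.
elim: k => [|k IHk] kN; first by rewrite !expr0 mxE eqxx.
rewrite exprSr mxE (bigD1 p) //= IHk; last by lia.
rewrite -exprSr big1 ?addr0 // => r rp.
have [pv|pv] := eqVneq (p : nat) (v r); last by rewrite B_eq0 ?mulr0 // eq_sym.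
(* A last step into p would start at its predecessor, N + 1 steps ahead of p and out of reach. *)
by rewrite Bk_eq0 ?mul0r // pv dist_pred.
Qed.

Let tr_init k : (0 < k <= N.+1)%N -> \tr (B ^+ k) = 2 ^+ k.+1.
Proof.
move=> k_bnd; rewrite /mxtrace.
have diag (p : 'I_N.+2) : (B ^+ k) p p = if is_end p then 2 ^+ k else 0.
  rewrite Bk_diag; last by lia.
  have vp : (p == v p :> nat) = false.
    by have := ltn_ord p; rewrite /v /fmn_val; do ![case: ifP => ?]; lia.
  rewrite B_E vp eqxx; case: ifP => _; first by rewrite subr0.
  by rewrite expr0n; case: eqP k_bnd => // ->.
under eq_bigr do rewrite diag.
rewrite big_ord_recl big_ord_recr /= /is_end /= eqxx big1 ?add0r.
  by rewrite exprS; ring.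
by move=> i _; rewrite ifF //= /bump /=; have := ltn_ord i; lia.
Qed.

Lemma mxtrace_fmn k : (0 < k)%N -> \tr (A ^+ k) = a N.+2 k.
Proof.
move=> k_gt0; rewrite trAB (@a_from_trace _ (fun k => \tr (B ^+ k))) //.
- by lia.
- by rewrite expr0 mxtrace1 natz.
Qed.
End TraceFmn.

Definition f4_val (j : nat) : nat := nth 0%N [:: 3; 0; 3; 1]%N j.

(** The characteristic polynomial of A is x (x^2 - 3 x + 1), which matches the recurrence of
    [a 3]. *)
Lemma mxtrace_f4 k : (0 < k)%N -> \tr (adj_mx (@cover_rel 2 f4_val) ^+ k) = a 3 k.
Proof.
set A := adj_mx _.
have A3 : A ^+ 3 = A ^+ 2 *+ 3 - A.
  rewrite [A ^+ 3]exprS expr2; apply/matrixP => i j.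
  rewrite !(mxE, big_ord_recl, big_ord0) /=.
  by case: i => -[|[|[|]]] // ?; case: j => -[|[|[|]]] // ?.
elim/ltn_ind: k => -[//|[|[|k]]] IHk _.
- by rewrite expr1 /mxtrace !(mxE, big_ord_recl, big_ord0).
- by rewrite expr2 /mxtrace !(mxE, big_ord_recl, big_ord0).
rewrite a_recurrence // big_nat1 /= -(addn3 k) exprD A3 mulrBr mulrnAr -exprD -exprSr.
rewrite raddfB /= raddfMn /= addn2 !IHk //.
by rewrite mulr_natl; congr (_ - a _ _); lia.
Qed.

(** * Symbolic coding of a piecewise linear Markov map *)

Section MarkovMap.
Variables (R : realType) (N : nat) (v side mu : nat -> nat) (f : R -> R).

(* [side p] is the interval that codes the point [p]. *)
Let in_itv (i : nat) (x : R) := i.+1%:R <= x <= i.+2%:R.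
Let dom (x : R) := 1 <= x <= N.+2%:R.

Hypothesis f_dom : forall x, dom x -> dom (f x).
Hypothesis f_point : forall p, (p < N.+2)%N -> f p.+1%:R = (v p).+1%:R.
Hypothesis f_linear : forall i, (i < N.+1)%N -> linear_on i.+1%:R i.+2%:R f.
Hypothesis v_lt : forall p, (p < N.+2)%N -> (v p < N.+2)%N.
Hypothesis v_neq : forall i, (i < N.+1)%N -> v i != v i.+1.
Hypothesis sideP : forall p, (p < N.+2)%N ->
  (side p < N.+1)%N && ((side p == p) || ((side p).+1 == p)).
Hypothesis side_covers : forall p, (p < N.+2)%N -> covers v (side p) (side (v p)).
(* [mu] decreases along the isometric branches; the other branches are expanding,
   and turn the side that does not code an endpoint into one that does. *)
Hypothesis mu_or_expanding : forall i, (i < N.+1)%N ->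
  (forall j, (j < N.+1)%N -> covers v i j -> (mu j < mu i)%N) \/
  ((v i + 2 <= v i.+1)%N || (v i.+1 + 2 <= v i)%N) /\
  (forall p, (p == i) || (p == i.+1) -> side p != i -> covers v i (side (v p))).

Let slope i : R := (v i.+1)%:R - (v i)%:R.

Let fE i x : (i < N.+1)%N -> in_itv i x ->
  f x = (v i).+1%:R + slope i * (x - i.+1%:R).
Proof.
move=> iN ix; have [c [d cd]] := f_linear iN.
have := f_point (ltnW (n := N.+1) (m := i) iN); have := @f_point i.+1 iN.
rewrite !cd //; last first.
- by rewrite lexx ler_nat /= leqnSn.
- by rewrite lexx ler_nat /= leqnSn.
rewrite /slope -!natr1 => e1 e2.
have -> : (v i.+1)%:R - (v i)%:R = c by lra.
by rewrite -e2; ring.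
Qed.

Let slope_ge i : (i < N.+1)%N -> 1 <= slope i \/ slope i <= - 1.
Proof.
move=> iN; have := v_neq iN; rewrite /slope neq_ltn => /orP[] h.
  by left; move: h; rewrite -(ler_nat R) -natr1; lra.
by right; move: h; rewrite -(ler_nat R) -natr1; lra.
Qed.

Let code (x : R) : nat :=
  if x \is a Num.nat then side (Num.truncn x).-1 else (Num.truncn x).-1.

Let code_point p : code p.+1%:R = side p.
Proof. by rewrite /code natr_nat natrK. Qed.

Let code_inner i (x : R) : i.+1%:R < x < i.+2%:R -> code x = i.
Proof.
move=> /andP[ix xi]; rewrite /code; case: ifP => [/natrP[q xq]|_].
  by move: ix xi; rewrite xq !ltr_nat; lia.
by rewrite (@truncn_def _ _ i.+1) // ltW.
Qed.

Variant code_spec (x : R) : nat -> Prop :=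
| CodePoint p of (p < N.+2)%N & x = p.+1%:R : code_spec x (side p)
| CodeInner i of (i < N.+1)%N & i.+1%:R < x < i.+2%:R : code_spec x i.

Let codeP x : dom x -> code_spec x (code x).
Proof.
move=> xd; have [j jN jx] := cell (isT : (1 < N.+2)%N) xd.
case: j jN jx => [//|j] jN /andP[jx xj].
have [xE|jx'] := eqVneq x j.+1%:R.
  by rewrite xE code_point; apply: CodePoint => //; lia.
have [xE|xj'] := eqVneq x j.+2%:R.
  by rewrite xE code_point; apply: CodePoint.
have xin : j.+1%:R < x < j.+2%:R by rewrite !lt_neqAle eq_sym jx' jx xj' xj.
by rewrite (code_inner xin); apply: CodeInner.
Qed.

Let code_lt x : dom x -> (code x < N.+1)%N.
Proof. by move=> /codeP[p /sideP/andP[]|]. Qed.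

Let in_itv_code x : dom x -> in_itv (code x) x.
Proof.
move=> /codeP[p pN ->|i _ /andP[ix xi]]; last by rewrite /in_itv !ltW.
by rewrite /in_itv !ler_nat; have := sideP pN; lia.
Qed.

Let dom_itv i x : (i < N.+1)%N -> in_itv i x -> dom x.
Proof.
move=> iN /andP[ix xi]; rewrite /dom (le_trans _ ix) ?(le_trans xi) ?ler_nat //.
by rewrite -[1]/(1%:R) ler_nat.
Qed.

Let image_inner i x : (i < N.+1)%N -> i.+1%:R < x < i.+2%:R ->
  (minn (v i) (v i.+1)).+1%:R < f x < (maxn (v i) (v i.+1)).+1%:R.
Proof.
move=> iN /andP[ix xi]; rewrite (@fE i) //; last by rewrite /in_itv !ltW.
move: ix xi; rewrite -!(natr1 i.+1) /slope => ix xi.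
have := v_neq iN; rewrite neq_ltn => /orP[] h.
  rewrite (minn_idPl (ltnW h)) (maxn_idPr (ltnW h)).
  by move: h; rewrite -(ltr_nat R) -!(natr1 (v _)); nra.
rewrite (minn_idPr (ltnW h)) (maxn_idPl (ltnW h)).
by move: h; rewrite -(ltr_nat R) -!(natr1 (v _)); nra.
Qed.

Let covers_code x : dom x -> covers v (code x) (code (f x)).
Proof.
move=> xd; have fxd := f_dom xd.
case: (codeP xd) => [p pN xE|i iN xi].
  by rewrite xE f_point // code_point side_covers.
(* An inner point maps strictly inside the image of its interval, so both sides of an integer image
   are covered. *)
have /andP[lo hi] := image_inner iN xi; rewrite /covers.
case: (codeP fxd) => [q qN fxE|j jN /andP[jx xj]].
  by move: lo hi; rewrite fxE !ltr_nat; have := sideP qN; lia.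
have := lt_trans lo xj; have := lt_trans jx hi; rewrite !ltr_nat; lia.
Qed.

Let f_onto i j t : (i < N.+1)%N -> covers v i j -> in_itv j t ->
  exists2 s, in_itv i s & f s = t.
Proof.
move=> iN cij /andP[jt tj].
have sl0 : slope i != 0 by have [] := slope_ge iN; lra.
pose y := (t - (v i).+1%:R) / slope i.
have yE : slope i * y = t - (v i).+1%:R by rewrite mulrC divfK.
have y01 : 0 <= y <= 1.
  move: cij; rewrite /covers; have := v_neq iN; rewrite neq_ltn => /orP[] h.
    rewrite (minn_idPl (ltnW h)) (maxn_idPr (ltnW h)) -!(ler_nat R) => /andP[].
    move: h yE jt tj; rewrite -(ltr_nat R) /slope -!natr1 => *; apply/andP; split; nra.
  rewrite (minn_idPr (ltnW h)) (maxn_idPl (ltnW h)) -!(ler_nat R) => /andP[].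
  move: h yE jt tj; rewrite -(ltr_nat R) /slope -!natr1 => *; apply/andP; split; nra.
have iy : in_itv i (i.+1%:R + y).
  by move: y01; rewrite /in_itv -(natr1 i.+1); lra.
exists (i.+1%:R + y) => //; rewrite (fE iN iy) addrAC subrr add0r yE; ring.
Qed.

Let f_convex i x y l : (i < N.+1)%N -> in_itv i x -> in_itv i y -> 0 <= l <= 1 ->
  in_itv i (l * x + (1 - l) * y) /\
  f (l * x + (1 - l) * y) = l * f x + (1 - l) * f y.
Proof.
move=> iN ix iy l01.
have iz : in_itv i (l * x + (1 - l) * y).
  move: ix iy l01 => /andP[? ?] /andP[? ?] /andP[? ?].
  by apply/andP; split; nra.
by split=> //; rewrite (fE iN ix) (fE iN iy) (fE iN iz); ring.
Qed.

Let walk k (w : nat -> nat) := forall i, (i <= k)%N -> (w i < N.+1)%N /\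
  ((i < k)%N -> covers v (w i) (w i.+1)).

Let follows k (w : nat -> nat) x := forall i, (i <= k)%N -> in_itv (w i) (iter i f x).

Let walk_pullback k w t : walk k w -> in_itv (w k) t ->
  exists2 s, follows k w s & iter k f s = t.
Proof.
elim: k t => [|k IHk] t wk kt; first by exists t => // -[].
have [wkN cov] := wk k (leqnSn k).
have [s1 s1k fs1] := f_onto wkN (cov (ltnSn k)) kt.
have [|s sw ks] := IHk s1 _ s1k.
  move=> i ik; have [wiN ci] := wk i (leqW ik); split=> // ik'.
  by apply: ci; rewrite ltnS.
exists s; last by rewrite iterS ks.
by move=> i; rewrite leq_eqVlt => /orP[/eqP -> /=|/sw//]; rewrite ks fs1.
Qed.

(** Each branch is affine, so along one walk every iterate is affine and the points following it
    form a convex set. *)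
Let follows_convex k w x y l : walk k w -> follows k w x -> follows k w y ->
  0 <= l <= 1 -> forall i, (i <= k)%N ->
  in_itv (w i) (iter i f (l * x + (1 - l) * y)) /\
  iter i f (l * x + (1 - l) * y) = l * iter i f x + (1 - l) * iter i f y.
Proof.
move=> wk wx wy l01; elim=> [|i IHi] ik.
  by split=> //; have [] := f_convex (wk 0%N ik).1 (wx 0%N ik) (wy 0%N ik) l01.
have [_ IH] := IHi (ltnW ik).
have E : iter i.+1 f (l * x + (1 - l) * y) = l * iter i.+1 f x + (1 - l) * iter i.+1 f y.
  rewrite !iterS IH.
  by have [] := f_convex (wk i (ltnW ik)).1 (wx i (ltnW ik)) (wy i (ltnW ik)) l01.
split=> //; rewrite E.
by have [] := f_convex (wk _ ik).1 (wx _ ik) (wy _ ik) l01.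
Qed.

(** Pull both ends of the first interval back along the walk to x and y. The iterate maps the
    segment between them affinely onto that interval, which contains x and y, so it fixes a point of
    the segment. *)
Let closed_walk_fixed k w : walk k w -> w k = w 0%N ->
  exists2 x, follows k w x & iter k f x = x.
Proof.
move=> wk wk0.
have [||x xw kx] := @walk_pullback k w (w 0%N).+1%:R; rewrite ?wk0 //.
  by rewrite /in_itv lexx ler_nat /= leqnSn.
have [||y yw ky] := @walk_pullback k w (w 0%N).+2%:R; rewrite ?wk0 //.
  by rewrite /in_itv lexx ler_nat /= leqnSn.
have /andP[x_lo x_hi] := xw 0%N (leq0n k); have /andP[y_lo y_hi] := yw 0%N (leq0n k).
rewrite /= in x_lo x_hi y_lo y_hi.
(* With al and be the gaps at the two ends, the equation reads l al = (1 - l) be; when both gaps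
   vanish, every l solves it. *)
have [l l01 lE] : exists2 l, 0 <= l <= 1 &
    l * (w 0%N).+1%:R + (1 - l) * (w 0%N).+2%:R = l * x + (1 - l) * y.
  pose al := x - (w 0%N).+1%:R; pose be := (w 0%N).+2%:R - y.
  have al0 : 0 <= al by rewrite subr_ge0.
  have be0 : 0 <= be by rewrite subr_ge0.
  have [ab0|ab0] := eqVneq (al + be) 0.
    by exists 0; rewrite ?lexx ?ler01 //; move: ab0 al0 be0; rewrite /al /be; lra.
  exists (be / (al + be)).
    have ab_gt0 : 0 < al + be by rewrite lt_def ab0 addr_ge0.
    apply/andP; split; first by rewrite divr_ge0 // ltW.
    by rewrite ler_pdivrMr // mul1r lerDr.
  have : be / (al + be) * (al + be) = be by rewrite divfK.
  by rewrite {1}/al {1 3}/be; set l := _ / _; rewrite /al /be; nra.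
have conv := follows_convex wk xw yw l01.
exists (l * x + (1 - l) * y) => [i /conv[]//|].
by have [_ ->] := conv k (leqnn k); rewrite kx ky.
Qed.

(** Slopes are at least 1 in absolute value, so the distance never shrinks, and it grows at an
    expanding branch. Without such a branch [mu] would decrease all along a closed walk. *)
Let walk_fixed_inj k w x y : (0 < k)%N -> walk k w -> w k = w 0%N ->
  follows k w x -> follows k w y -> iter k f x = x -> iter k f y = y -> x = y.
Proof.
move=> k_gt0 wk wk0 wx wy kx ky; apply/eqP; apply: contraT => xy.
have d0 : 0 < `|x - y| by rewrite normr_gt0 subr_eq0.
have step i : (i < k)%N ->
    `|iter i.+1 f x - iter i.+1 f y| = `|slope (w i)| * `|iter i f x - iter i f y|.
  move=> ik; have iN := (wk i (ltnW ik)).1.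
  rewrite !iterS (fE iN (wx i (ltnW ik))) (fE iN (wy i (ltnW ik))) -normrM.
  by congr `|_|; ring.
have : forall i, (i <= k)%N -> `|x - y| <= `|iter i f x - iter i f y| /\
    (`|x - y| < `|iter i f x - iter i f y| \/ i = 0%N \/ (mu (w i) < mu (w 0%N))%N).
  elim=> [|i IHi] ik; first by split=> //; right; left.
  have [le_i alt] := IHi (ltnW ik); have [iN ci] := wk i (ltnW ik).
  rewrite step //; have sl1 : 1 <= `|slope (w i)|.
    by rewrite ler_normr; have [] := slope_ge iN => ?; apply/orP; [left|right]; lra.
  split; first by nra.
  have [dec|[exp _]] := mu_or_expanding iN; last first.
    left; have sl2 : 2 <= `|slope (w i)|.
      rewrite ler_normr /slope; move: exp; rewrite -!(ler_nat R) !natrD => /orP[] ?.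
        by apply/orP; left; lra.
      by apply/orP; right; lra.
    by nra.
  have {}dec := dec _ (wk _ ik).1 (ci ik).
  case: alt => [lt_i|alt]; [left; nra|right; right].
  by case: alt => [i0|]; [subst i | exact: ltn_trans].
move=> /(_ k (leqnn k)) [_]; rewrite kx ky wk0 ltxx ltnn => -[//|[k0|//]].
by rewrite k0 in k_gt0.
Qed.

Let point_orbit p : (p < N.+2)%N -> forall i, exists2 q, (q < N.+2)%N & iter i f p.+1%:R = q.+1%:R.
Proof.
move=> pN; elim=> [|i [q qN qE]]; first by exists p.
by exists (v q); [exact: v_lt | rewrite iterS qE f_point].
Qed.

(** Off the integer points the interval is forced. On an integer orbit, agreement with the code
    persists, so a closed walk agrees always or never; if never, [mu] would decrease all along
    it. *)
Let walk_code k w x : (0 < k)%N -> walk k w -> w k = w 0%N -> follows k w x ->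
  iter k f x = x -> forall i, (i <= k)%N -> w i = code (iter i f x).
Proof.
move=> k_gt0 wk wk0 wx kx.
have [xnat|xNnat] := pselect (exists2 p, (p < N.+2)%N & x = p.+1%:R); last first.
  move=> i ik; have /andP[lo hi] := wx i ik.
  have Npt q : (q < N.+2)%N -> iter i f x != q.+1%:R.
    move=> qN; apply/eqP => iq; apply: xNnat.
    have [r rN rE] := point_orbit qN (k - i).
    by exists r => //; rewrite -rE -iq -iterD subnK.
  apply/esym/code_inner; rewrite !lt_neqAle lo hi eq_sym !Npt //.
  - by have := (wk i ik).1; lia.
  - by have := (wk i ik).1; lia.
have [p pN xp] := xnat.
have adjacent q i : (i <= k)%N -> iter i f x = q.+1%:R -> (q == w i) || (q == (w i).+1).
  by move=> ik iq; have := wx i ik; rewrite /in_itv iq !ler_nat; lia.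
(* Since q is an endpoint of [w i], only one of the intervals at v q is covered by [w i]; both
   [w i.+1] and the code of v q are that one. *)
have right_step i : (i < k)%N -> w i = code (iter i f x) -> w i.+1 = code (iter i.+1 f x).
  move=> ik wi; have [q qN iq] := point_orbit pN i; rewrite -xp in iq.
  have iSq : iter i.+1 f x = (v q).+1%:R by rewrite iterS iq f_point.
  rewrite iSq code_point; move: wi; rewrite iq code_point => wi.
  have := (wk i (ltnW ik)).2 ik; have := adjacent _ _ ik iSq.
  have := sideP (v_lt qN); have := side_covers qN; have := sideP qN; rewrite -wi /covers.
  move=> /andP[_ /orP[/eqP qE|/eqP qE]]; rewrite -?qE; lia.
have wrong_step i : (i < k)%N -> w i != code (iter i f x) ->
    w i.+1 = code (iter i.+1 f x) \/ (mu (w i.+1) < mu (w i))%N.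
  move=> ik wi; have [q qN iq] := point_orbit pN i; rewrite -xp in iq.
  have [wiN cov] := wk i (ltnW ik).
  have iSq : iter i.+1 f x = (v q).+1%:R by rewrite iterS iq f_point.
  have [dec|[_ turn]] := mu_or_expanding wiN.
    by right; apply: dec (wk _ ik).1 (cov ik).
  left; rewrite iSq code_point; move: wi; rewrite iq code_point eq_sym => wi.
  have := adjacent _ _ (ltnW ik) iq => aq; have {}turn := turn q aq wi.
  have := cov ik; have := adjacent _ _ ik iSq.
  have := sideP (v_lt qN); move: turn; rewrite /covers.
  by case/orP: aq => /eqP ->; lia.
have right_all j i : (j <= i <= k)%N -> w j = code (iter j f x) -> w i = code (iter i f x).
  move=> /andP[ji ik] wj; elim: i ji ik => [|i IHi].
    by rewrite leqn0 => /eqP <-.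
  rewrite leq_eqVlt => /orP[/eqP <- //|ji] ik.
  by apply: right_step => //; apply: IHi => //; apply: ltnW.
suff w0 : w 0%N = code x by move=> i ik; apply: (right_all 0%N).
apply/eqP; apply: contraT => w0.
have wrong i : (i <= k)%N -> w i != code (iter i f x).
  move=> ik; apply: contra w0 => /eqP wi.
  have := right_all i k; rewrite ik leqnn kx wk0 => /(_ isT wi) ->.
  exact: eqxx.
have : forall i, (i <= k)%N -> i = 0%N \/ (mu (w i) < mu (w 0%N))%N.
  elim=> [|i IHi] ik; [by left|right].
  have [wi|lt_i] := wrong_step i ik (wrong i (ltnW ik)).
    by have := wrong i.+1 ik; rewrite wi eqxx.
  by have [i0|] := IHi (ltnW ik); [subst i | exact: ltn_trans].
move=> /(_ k (leqnn k)); rewrite wk0 ltnn => -[k0|//].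
by rewrite k0 in k_gt0.
Qed.

Let code_walk k x : (0 < k)%N -> dom x -> iter k f x = x ->
  [/\ walk k (fun i => code (iter i f x)), follows k (fun i => code (iter i f x)) x &
      code (iter k f x) = code (iter 0 f x)].
Proof.
move=> k_gt0 xd kx; have xid i : dom (iter i f x) by elim: i => //= i; apply: f_dom.
split=> [i _|i _|]; last by rewrite kx.
  by split=> [|_]; [exact: code_lt | exact: covers_code].
exact: in_itv_code.
Qed.

(** Starts at f x, so that for a fixed point of f^k the last entry is the code of x, as in the
    closed walk tuples. *)
Let itinerary k x : k.-tuple 'I_N.+1 := [tuple inord (code (iter i.+1 f x)) | i < k].

Let nth_itinerary k x i : (i < k)%N -> dom x ->
  nth ord0 (itinerary k x) i = code (iter i.+1 f x) :> nat.
Proof.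
move=> ik xd; rewrite (nth_mktuple _ _ (Ordinal ik)) inordK // code_lt //.
have : forall j, dom (iter j f x) by elim=> //= j; apply: f_dom.
exact.
Qed.

(** [itinerary] is a bijection: injective by [walk_fixed_inj], onto by [closed_walk_fixed] and
    [walk_code]. *)
Lemma markov_fixed_points k : (0 < k)%N ->
  (fixed_points f k N.+2 #= `I_#|[pred t : k.-tuple 'I_N.+1 |
     path (@cover_rel N v) (last ord0 t) t]|)%card.
Proof.
move=> k_gt0; set P := [pred t | _].
have last_nth (t : k.-tuple 'I_N.+1) : last ord0 t = nth ord0 t k.-1.
  by rewrite -nth_last size_tuple.
have inj : {in fixed_points f k N.+2 &, injective (itinerary k)}.
  move=> x y /set_mem[xd kx] /set_mem[yd ky] xy.
  have codeS i : (i < k)%N -> code (iter i.+1 f x) = code (iter i.+1 f y).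
    by move=> ik; rewrite -(nth_itinerary ik xd) -(nth_itinerary ik yd) xy.
  have codeE i : (i <= k)%N -> code (iter i f x) = code (iter i f y).
    case: i => [_|i]; last exact: codeS.
    by have := codeS k.-1; rewrite prednK // kx ky; apply.
  have [wk wx wk0] := code_walk k_gt0 xd kx; have [_ wy _] := code_walk k_gt0 yd ky.
  by apply: (walk_fixed_inj k_gt0 wk) => // i ik; rewrite codeE //; apply: wy.
have img : (itinerary k @` fixed_points f k N.+2 = [set t | P t])%classic.
  apply/seteqP; split=> [_ [x [xd kx] <-]|t /= Pt].
    have [wk _ wk0] := code_walk k_gt0 xd kx.
    move: (fun i ik => @nth_itinerary k x i ik xd); move: (itinerary k x) => t nthE /=.
    apply/(pathP ord0) => i; rewrite size_tuple => ik; rewrite /cover_rel nthE //.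
    have := (wk i (ltnW ik)).2 ik; case: i ik => [|i] ik /=; last by rewrite nthE // ltnW.
    by rewrite last_nth nthE ?prednK // kx.
  pose w i : nat := nth ord0 (last ord0 t :: t) i.
  have wk : walk k w.
    move=> i ik; split=> [|ik']; first exact: ltn_ord.
    by move/(pathP ord0) : Pt => /(_ i); rewrite size_tuple => /(_ ik').
  have wk0 : w k = w 0%N.
    by rewrite /w /= last_nth; move: (tval t) => s; case: (k) (k_gt0).
  have [x wx kx] := closed_walk_fixed wk wk0.
  have xd : dom x by apply: dom_itv (wk 0%N _).1 (wx 0%N _).
  exists x; first by split.
  apply/val_inj/(@eq_from_nth _ ord0); rewrite !size_tuple // => i ik.
  apply: val_inj; rewrite /= nth_itinerary //.
  by rewrite -(walk_code k_gt0 wk wk0 wx kx).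
rewrite -(card_eql (inj_card_eq inj)) img.
have -> : [set t | P t]%classic = [set` [fset t | t in P]%fset]%classic.
  apply/seteqP; split=> t /=; first by move=> Pt; apply/imfsetP; exists t.
  by move=> /imfsetP[u Pu ->].
by apply/card_eq_fsetP; rewrite card_imfset ?cardE.
Qed.
End MarkovMap.

(** * Fixed points of the given maps *)

Lemma has_card_trace (R : realType) (N : nat) (v : nat -> nat) (A : set R) k z :
  (0 < k)%N -> \tr (adj_mx (@cover_rel N v) ^+ k) = z ->
  (A #= `I_#|[pred t : k.-tuple 'I_N.+1 |
     path (@cover_rel N v) (last ord0 t) t]|)%card -> has_card A z.
Proof. by move=> k_gt0 <- AI; eexists; first exact: AI; rewrite mxtrace_adj_mx_exp. Qed.

Lemma fmn_fixed_points (R : realType) n m (f : R -> R) :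
  (4 <= n)%N -> (1 < m < n.-1)%N -> is_fmn m n f ->
  forall k, (0 < k)%N -> has_card (fixed_points f k n) (a n k).
Proof.
move=> n4 hm [f_dom _ f1 f_low f_high fn f_lin] k k_gt0.
have [N nE] : exists N, n = N.+2 by exists (n - 2)%N; lia.
rewrite {}nE /= in n4 hm f_dom f_high fn f_lin *.
have mN : (1 < m <= N)%N by lia.
(* The ends have one side each; carrying it along the cycle, with a flip at each end, codes points
   below m on the right and the others on the left. *)
pose side p := if (p < m)%N then p else p.-1.
(* Slope-one branches move i to i - 1 for 0 < i < m - 1 and to i + 1 for m <= i < N; [mu] drops in
   both cases. *)
pose mu i := if (i < m.-1)%N then i else (N.+2 - i)%N.
apply: (has_card_trace k_gt0 (mxtrace_fmn mN k_gt0)).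
apply: (@markov_fixed_points R N (fmn_val N m) side mu f) => //.
- move=> p pN; rewrite /fmn_val.
  case: ifP => [/eqP -> //|p0]; case: ifP => pm; first by rewrite f_low; [congr _%:R|]; lia.
  case: ifP => pN'; first by rewrite f_high //; lia.
  have -> : p = N.+1 by lia.
  by rewrite fn prednK //; lia.
- by move=> i iN; apply: f_lin.
- by move=> p pN; rewrite /fmn_val; do ![case: ifP => ?]; lia.
- by move=> i iN; rewrite /fmn_val; do ![case: ifP => ?]; lia.
- by move=> p pN; rewrite /side; case: ifP => ?; lia.
- move=> p pN.
  have -> : side (fmn_val N m p) = if p == 0%N then m.-1 else if (p < m)%N then p.-1
                                   else if (p < N.+1)%N then p else m.-1.
    by rewrite /fmn_val; do ![case: ifP => ?]; rewrite /side; case: ifP => ?; lia.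
  by rewrite /side /covers; do ![case: ifP => ?]; rewrite /fmn_val; do ![case: ifP => ?]; lia.
- move=> i iN.
  have [i_mid|i_end] := boolP ((0 < i < m.-1)%N || (m <= i < N)%N).
    left=> j jN; rewrite /covers /fmn_val /mu; do ![case: ifP => ?]; lia.
  right; split; first by rewrite /fmn_val; do ![case: ifP => ?]; lia.
  move=> p pi; rewrite /side => si.
  (* The expanding intervals are 0, m - 1 and N; the middle one codes both its endpoints. *)
  have [[-> pE]|[-> pE]] : i = 0%N /\ p = 1%N \/ i = N /\ p = N.
  + by move: si; case: ifP => ?; lia.
  + by rewrite pE /covers /fmn_val /=; do ![case: ifP => ? /=]; lia.
  + have -> : fmn_val N m p = N.+1 by rewrite pE /fmn_val; do ![case: ifP => ?]; lia.
    by rewrite /covers /fmn_val; do ![case: ifP => ?]; lia.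
Qed.

Lemma f4_fixed_points (R : realType) (f : R -> R) : is_f4 f ->
  forall k, (0 < k)%N -> has_card (fixed_points f k 4) (a 3 k).
Proof.
move=> [f_dom _ f1 f2 f3 f4 f12 f23 f34] k k_gt0.
apply: (has_card_trace k_gt0 (mxtrace_f4 k_gt0)).
(* All branches expand, with slopes 3, 3 and 2 in absolute value. *)
apply: (@markov_fixed_points R 2 f4_val (nth 0%N [:: 0; 1; 1; 2]%N) id f) => //.
- by case=> [|[|[|[|]]]].
- by case=> [|[|[|]]].
- by case=> [|[|[|[|]]]].
- by case=> [|[|[|]]].
- by case=> [|[|[|[|]]]].
- by case=> [|[|[|[|]]]].
- by case=> [|[|[|]]] //= _; right; split=> //; case=> [|[|[|[|]]]].
Qed.

Theorem theorem2 (R : realType) :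
  ( (forall f : R -> R, is_f4 f ->
       forall k : nat, (1 <= k)%N -> has_card (fixed_points f k 4) (a 3 k))
    /\ (forall n m : nat, (4 <= n)%N -> (1 < m < n.-1)%N ->
          forall f : R -> R, is_fmn m n f ->
          forall k : nat, (1 <= k)%N -> has_card (fixed_points f k n) (a n k))
    /\ (forall n : nat, (3 <= n)%N ->
          forall k : nat, (1 <= k)%N -> (Phi1 k (a n) = 0 %[mod k%:Z])%Z) )
  /\ (forall n : nat, (3 <= n)%N -> gen_fun n = gen_num n / gen_den n).
Proof.
split; last first.
  by move=> n n3; rewrite -(gen_fun_mul_den n3) mulrK // gen_den_unit.
split; first exact: f4_fixed_points.
split=> [n m n4 hm f ff|n n3]; first exact: fmn_fixed_points ff.
have [n4|n_lt4] := leqP 4 n.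
  (* The count does not depend on m, and m = 2 is admissible for every n >= 4. *)
  have hm : (1 < 2 < n.-1)%N by lia.
  have [f ff] := is_fmn_exists R n4 hm.
  exact: Phi1_fixed_points (fmn_maps ff) (fmn_fixed_points n4 hm ff).
have -> : n = 3%N by lia.
have [f ff] := is_f4_exists R.
exact: (@Phi1_fixed_points _ _ 4) (f4_maps ff) (f4_fixed_points ff).
Qed.
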